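(* Let $X$ be a uniformly convex Banach space and let $\{r_j\}_{j\ge1}$ be the sequence associated with $X$ by $r_1=1$ and, for every natural $j$, $r_{j+1}$ being the unique solution of $r_{j+1}\cdot\zeta^-_X(r_{j+1})=r_j$. Let $k\ge1$ be a natural number and let $\mathcal{F}_1,\dots,\mathcal{F}_k$ be finite and non-empty families of convex sets in $X$. If for every rainbow $k$-tuple $K_1\in\mathcal{F}_1,\dots,K_k\in\mathcal{F}_k$ the set $\bigcap_{i=1}^kK_i$ contains a point of the unit ball $\mathbf{B}$, then there exist $x\in X$ and $i\in\{1,\dots,k\}$ such that all the sets in $\mathcal{F}_i$ intersect the ball $r_k\mathbf{B}+x$.
   Context: Banach spaces are real, of dimension at least $2$. $\mathbf{B}=\{x\in X:\|x\|\le1\}$. A rainbow $k$-tuple is a choice of one set from each of $\mathcal{F}_1,\dots,\mathcal{F}_k$. The modulus of convexity is $\delta_X(\varepsilon)=\inf\{1-\frac{\|x+y\|}{2}: x,y\in\mathbf{B},\ \|x-y\|\ge\varepsilon\}$, $\varepsilon\in[0,2]$; $X$ is uniformly convex if $\delta_X>0$ on $(0,2]$. For $x\ne0$, $y$ is quasi-orthogonal to $x$, written $y\urcorner x$, if there is a non-zero continuous linear functional $p$ with $p(x)=\|p\|\|x\|$ and $p(y)=0$ (equivalently, $\|x+\lambda y\|\ge\|x\|$ for all $\lambda\in\mathbb{R}$). The function $\zeta^-_X:[0,\infty)\to[0,\infty)$ is $\zeta^-_X(\varepsilon)=\inf\{\|x+\varepsilon y\|:\|x\|=\|y\|=1,\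 y\urcorner x\}$. The sequence $\{r_j\}$ is well-defined. *)

(* Defs.v *)
From HB Require Import structures.
From mathcomp Require Import all_boot all_order all_algebra.
From mathcomp Require Import all_classical all_reals all_analysis.

Set Implicit Arguments.
Unset Strict Implicit.
Unset Printing Implicit Defensive.

Import Order.TTheory GRing.Theory Num.Theory.
Import numFieldNormedType.Exports.

Local Open Scope classical_set_scope.
Local Open Scope ring_scope.

Definition dim_ge2 (R : realType) (X : normedModType R) : Prop :=
  exists u v : X, forall a b : R, a *: u + b *: v = 0 -> a = 0 /\ b = 0.

Definition unit_ball (R : realType) (X : normedModType R) : set X :=
  [set x | `|x| <= 1].

Arguments unit_ball {R} X.

(* The real-valued [inf] is the genuine infimum for eps in [0, 2] when X is
   nontrivial: the set is then nonempty and bounded below by 0. *)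
Definition modulus_of_convexity (R : realType) (X : normedModType R)
    (eps : R) : R :=
  inf [set t | exists x y : X,
    [/\ unit_ball X x, unit_ball X y, eps <= `|x - y|
      & t = 1 - `|x + y| / 2]].

Arguments modulus_of_convexity {R} X eps.

Definition uniformly_convex (R : realType) (X : normedModType R) : Prop :=
  forall eps : R, 0 < eps -> eps <= 2 -> 0 < modulus_of_convexity X eps.

(* Used only for continuous p, for which the supremum is finite. *)
Definition dual_norm (R : realType) (X : normedModType R)
    (p : {linear X -> R^o}) : R :=
  sup [set `|p v| | v in unit_ball X].

(* [quasi_orthogonal y x] is "y is quasi-orthogonal to x"; x is meant to be
   nonzero. *)
Definition quasi_orthogonal (R : realType) (X : normedModType R)
    (y x : X) : Prop :=
  exists p : {linear X -> R^o},
    [/\ continuous p, exists v, p v != 0,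
        p x = dual_norm p * `|x| & p y = 0].

Definition zeta_minus (R : realType) (X : normedModType R) (eps : R) : R :=
  inf [set t | exists x y : X,
    [/\ `|x| = 1, `|y| = 1, quasi_orthogonal y x & t = `|x + eps *: y|]].

Arguments zeta_minus {R} X eps.

(* The sequence is indexed from 1; the value at 0 is irrelevant.  For X of
   dimension at least 2, the equation s * zeta_minus X s = r has exactly one
   solution s >= 0 for every r >= 0, and [get] returns it. *)
Fixpoint ball_radius_seq (R : realType) (X : normedModType R) (j : nat) : R :=
  match j with
  | (_.+1 as i).+1 =>
      get [set s : R | 0 <= s /\ s * zeta_minus X s = ball_radius_seq X i]
  | _ => 1
  end.

Arguments ball_radius_seq {R} X j.

(* Main.v *)
Require Import Defs.
From HB Require Import structures.
From mathcomp Require Import all_boot all_order all_algebra.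
From mathcomp Require Import all_classical all_reals all_analysis.
From mathcomp Require Import ring lra.

Set Implicit Arguments.
Unset Strict Implicit.
Unset Printing Implicit Defensive.

Import Order.TTheory GRing.Theory Num.Theory.
Import numFieldNormedType.Exports.

Local Open Scope classical_set_scope.
Local Open Scope ring_scope.

(** The proof is by induction on the number of families, with the unit ball
replaced by a ball [rho B] of arbitrary radius.  For one family the ball
[rho B] itself does.  For one family more, let [r] be the new radius and
[Z = zeta_minus X r], so that [r Z] is the old radius.  If every rainbow tuple
of the families other than the last one has a common point in [(rho / Z) B],
the induction hypothesis for this smaller ball gives the radius
[r Z (rho / Z) = r rho].  Otherwise some rainbow tuple of these families has an
intersection [C] disjoint from [(rho / Z) B].  Each set of the last family
meets [C] inside [rho B], so it suffices that the cap [C] cut by [rho B] lies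
in one ball of radius [r rho] (cap_in_ball).

Its centre is the point [c] of the closure of [C] nearest to the origin, which
exists by completeness and uniform convexity (nearest_point); thus
[rho / Z <= |c| <= rho].  The key estimate (norm_add_ge_zeta_minus) is
[|z| >= |c| zeta_minus X (|z - c| / |c|)] for [z] in [C].  When [z - c] is
quasi-orthogonal to [c] this is the definition of [zeta_minus].  In general
minimality of [c] only gives a functional supporting the ball at [c] which is
nonnegative at [z - c] (supporting_functional), and a planar monotonicity
argument (norm_monotonicity) shows that tilting the direction away from the
kernel of the functional can only increase the norm.  As
[|z| <= rho <= Z |c|], the value of [zeta_minus] at [|z - c| / |c|] is at most
[Z], and strict monotonicity of [zeta_minus] beyond the point where it exceeds
[1] (zeta_minus_lt) yields [|z - c| <= r |c| <= r rho].

The supporting functionals come from the Hahn-Banach theorem, proved here in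
the form that every sublinear function dominates a linear one. *)

(** * The Hahn-Banach theorem *)

Section hahn_banach.
Context {R : realType} {X : lmodType R}.
Implicit Types (q : X -> R) (x y : X) (a t : R).

(** Homogeneity is required only as an inequality, which is easier to check
for infima; equality follows by scaling back (sublinearZ). *)
Definition sublinear q :=
  (forall x y, q (x + y) <= q x + q y) /\
  (forall a x, 0 <= a -> q (a *: x) <= a * q x).

Lemma sublinear0 q : sublinear q -> q 0 = 0.
Proof.
move=> [qD qZ]; apply/eqP; rewrite eq_le; apply/andP; split.
  by have := qZ 0 0 (lexx 0); rewrite scale0r mul0r.
by have := qD 0 0; rewrite addr0; lra.
Qed.

Lemma sublinearZ q a x : sublinear q -> 0 <= a -> q (a *: x) = a * q x.
Proof.
move=> sq; rewrite le_eqVlt => /predU1P[<-|a0].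
  by rewrite scale0r mul0r sublinear0.
apply/eqP; rewrite eq_le sq.2 ?(ltW a0)//= mulrC -ler_pdivlMr//.
have := sq.2 a^-1 (a *: x); rewrite scalerA mulVf ?gt_eqF// scale1r mulrC.
by apply; rewrite invr_ge0 ltW.
Qed.

Lemma sublinear_geN q x : sublinear q -> - q (- x) <= q x.
Proof.
by move=> sq; have := sq.1 x (- x); rewrite subrr sublinear0//; lra.
Qed.

Lemma le_infD (A B : set R) (c : R) : A !=set0 -> B !=set0 ->
  (forall a b, A a -> B b -> c <= a + b) -> c <= inf A + inf B.
Proof.
move=> A0 B0 AB; rewrite -lerBlDr; apply: lb_le_inf => // a Aa.
rewrite lerBlDr addrC -lerBlDr; apply: lb_le_inf => // b Bb.
by rewrite lerBlDr addrC; exact: AB.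
Qed.

(** By convexity the infimum is the limit for large [t]: this is the one-sided
directional derivative of [q] at [y] in the direction [x], so for the norm it
encodes the functionals supporting the ball at [y].  It is the largest
sublinear function below [q] that agrees with [q] at [y] and is linear on the
line of [y]. *)
Definition tilt q y x :=
  inf [set q (x + t *: y) - t * q y | t in [set t : R | 0 <= t]].

Lemma tilt_le q y x t : sublinear q -> 0 <= t ->
  tilt q y x <= q (x + t *: y) - t * q y.
Proof.
move=> sq t0; apply: ge_inf; last by exists t.
exists (- q (- x)) => _ [u /= u0 <-].
have := sq.1 (x + u *: y) (- x); rewrite addrAC subrr add0r sublinearZ//; lra.
Qed.

Lemma tilt_nonempty q y x :
  [set q (x + t *: y) - t * q y | t in [set t : R | 0 <= t]] !=set0.
Proof. by exists (q (x + 0 *: y) - 0 * q y), 0 => /=. Qed.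

Lemma tilt_le0 q y x : sublinear q -> tilt q y x <= q x.
Proof.
by move=> /(tilt_le y x)/(_ (lexx 0)); rewrite scale0r addr0 mul0r subr0.
Qed.

Lemma tilt_sublinear q y : sublinear q -> sublinear (tilt q y).
Proof.
move=> sq; split=> [x1 x2|a x].
  apply: le_infD; [exact: tilt_nonempty..|].
  move=> _ _ [t1 /= t10 <-] [t2 /= t20 <-].
  apply: (le_trans (tilt_le _ _ sq (addr_ge0 t10 t20))).
  rewrite scalerDl addrACA; have := sq.1 (x1 + t1 *: y) (x2 + t2 *: y); lra.
rewrite le_eqVlt => /predU1P[<-|a0].
  by rewrite scale0r mul0r -(sublinear0 sq) tilt_le0.
rewrite mulrC -ler_pdivrMr//; apply: lb_le_inf; first exact: tilt_nonempty.
move=> _ [t /= t0 <-]; rewrite ler_pdivrMr//.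
apply: (le_trans (tilt_le _ _ sq (mulr_ge0 (ltW a0) t0))).
by rewrite -scalerA -scalerDr sublinearZ ?(ltW a0)//; lra.
Qed.

Lemma tiltN q y : sublinear q -> tilt q y (- y) <= - q y.
Proof.
move=> sq; have := tilt_le y (- y) sq ler01.
by rewrite scale1r addNr sublinear0// mul1r sub0r.
Qed.

(** Zorn's lemma applies because the infimum of a chain below [q0] is finite:
every sublinear [q <= q0] satisfies [q x >= - q (- x) >= - q0 (- x)]. *)
Lemma minimal_sublinear q0 : sublinear q0 ->
  exists q, [/\ sublinear q, forall x, q x <= q0 x
    & forall q', sublinear q' -> (forall x, q' x <= q x) -> q' = q].
Proof.
move=> sq0.
pose T := {q | sublinear q /\ forall x, q x <= q0 x}.
pose below (p q : T) := `[< forall x, sval q x <= sval p x >].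
have [||||[q [sq qq0]] qmin] := @Zorn T below.
- by move=> p; apply/asboolP.
- move=> p q r /asboolP pq /asboolP qr; apply/asboolP => x.
  exact: le_trans (qr x) (pq x).
- move=> [p hp] [q hq] /asboolP/= pq /asboolP/= qp; apply: eq_exist => /=.
  by apply/funext => x; apply/eqP; rewrite eq_le qp pq.
- move=> A Atot; have [[p0 Ap0]|A0] := pselect (A !=set0); last first.
    exists (exist _ q0 (conj sq0 (fun x => lexx (q0 x)))) => p Ap.
    by case: A0; exists p.
  pose m x := inf [set sval p x | p in A].
  have m_le x p : A p -> m x <= sval p x.
    move=> Ap; apply: ge_inf; last by exists p.
    exists (- q0 (- x)) => _ [r _ <-]; have [sr rq0] := svalP r.
    by apply: le_trans (sublinear_geN _ sr); rewrite lerN2.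
  have m0 x : [set sval p x | p in A] !=set0 by exists (sval p0 x), p0.
  have sm : sublinear m.
    split=> [x y|a x].
      (* of two members of the chain, the smaller one serves both points *)
      apply: le_infD => // _ _ [p Ap <-] [r Ar <-].
      have [sp _] := svalP p; have [sr _] := svalP r.
      have [/asboolP pr|/asboolP rp] := Atot p r Ap Ar.
        apply: (le_trans (m_le _ _ Ar)); apply: (le_trans (sr.1 _ _)).
        by rewrite lerD2r.
      apply: (le_trans (m_le _ _ Ap)); apply: (le_trans (sp.1 _ _)).
      by rewrite lerD2l.
    rewrite le_eqVlt => /predU1P[<-|a0].
      have [sp _] := svalP p0.
      by rewrite scale0r mul0r -(sublinear0 sp) m_le.
    rewrite mulrC -ler_pdivrMr//; apply: lb_le_inf => // _ [p Ap <-].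
    have [sp _] := svalP p.
    rewrite ler_pdivrMr//; apply: (le_trans (m_le _ _ Ap)).
    by rewrite mulrC sp.2 ?ltW.
  have mq0 x : m x <= q0 x.
    by apply: le_trans (m_le _ _ Ap0) _; case: (svalP p0).
  by exists (exist _ m (conj sm mq0)) => p Ap; apply/asboolP => x; exact: m_le.
exists q; split=> // q' sq' q'q.
have q'q0 x : q' x <= q0 x by exact: le_trans (q'q x) (qq0 x).
by have /qmin[] : below (exist _ q (conj sq qq0)) (exist _ q' (conj sq' q'q0))
  by exact/asboolP.
Qed.

(** A minimal sublinear function coincides with all its tilts, and this says
exactly that it is superadditive, hence additive. *)
Theorem hahn_banach q0 : sublinear q0 ->
  exists p : {linear X -> R^o}, forall x, p x <= q0 x.
Proof.
move=> /minimal_sublinear[q [sq qq0 qmin]].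
have qD x y : q (x + y) = q x + q y.
  apply/eqP; rewrite eq_le sq.1/=.
  have := tilt_le y x sq ler01; rewrite scale1r.
  by rewrite (qmin _ (tilt_sublinear y sq) (fun=> tilt_le0 _ _ sq)); lra.
have qN x : q (- x) = - q x.
  by have := qD x (- x); rewrite subrr sublinear0//; lra.
have qlin : linear (q : X -> R^o).
  move=> a x y; rewrite qD; congr (_ + _).
  have [a0|a0] := leP 0 a; first by rewrite sublinearZ.
  have := @sublinearZ q (- a) x sq; rewrite scaleNr qN mulNr => H.
  by apply: oppr_inj; apply: H; lra.
pose L := GRing.isLinear.Build R X R^o *:%R q qlin.
pose p : {linear X -> R^o} := HB.pack (q : X -> R^o) L.
by exists p.
Qed.

End hahn_banach.

(** * Supporting functionals and quasi-orthogonality *)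

Section supporting_functionals.
Context {R : realType} {X : normedModType R}.
Implicit Types (x y u v c w : X) (t : R) (p : {linear X -> R^o}).

Lemma norm_sublinear : sublinear (fun x : X => `|x|).
Proof.
split=> [x y|a x a0]; first exact: ler_normD.
by rewrite normrZ ger0_norm.
Qed.

(** Tilting the norm along [c] forces a dominated linear functional to support
the ball at [c]; the tilted norm is still nonnegative at [w], since the norm
does not decrease from [c] in the direction [w].  A second tilt along [w]
makes the functional inherit this nonnegativity. *)
Lemma supporting_functional c w :
  (forall t, 0 <= t -> `|c| <= `|c + t *: w|) ->
  exists p, [/\ forall x, p x <= `|x|, p c = `|c| & 0 <= p w].
Proof.
move=> cw; pose q := tilt (fun x => `|x|) c.
have sq : sublinear q by exact: tilt_sublinear norm_sublinear.
have q_norm x : q x <= `|x| := tilt_le0 c x norm_sublinear.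
have qw : 0 <= q w.
  apply: lb_le_inf; first exact: tilt_nonempty.
  move=> _ [t /= t0 <-]; rewrite subr_ge0.
  move: t0; rewrite le_eqVlt => /predU1P[<-|t0]; first by rewrite mul0r.
  have -> : w + t *: c = t *: (c + t^-1 *: w).
    by rewrite scalerDr scalerA divff ?gt_eqF// scale1r addrC.
  by rewrite normrZ gtr0_norm// ler_pM2l// cw// invr_ge0 ltW.
have [p pq] := hahn_banach (tilt_sublinear w sq).
have pq' x : p x <= q x by exact: le_trans (pq x) (tilt_le0 w x sq).
have p_norm x : p x <= `|x| by exact: le_trans (pq' x) (q_norm x).
exists p; split=> //.
- apply/eqP; rewrite eq_le p_norm/= -lerN2 -linearN.
  exact: le_trans (pq' _) (tiltN _ norm_sublinear).
- have := le_trans (pq (- w)) (tiltN _ sq); rewrite linearN/=; lra.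
Qed.

Lemma linear_le_norm p : (forall x, p x <= `|x|) -> forall x, `|p x| <= `|x|.
Proof.
by move=> pn x; rewrite ler_norml pn -(normrN x) lerNl -linearN pn.
Qed.

Lemma quasi_orthogonal_supporting p x y : (forall v, p v <= `|v|) ->
  `|x| = 1 -> p x = 1 -> p y = 0 -> quasi_orthogonal y x.
Proof.
move=> pn x1 px py; exists p; split=> //.
- apply: bounded_linear_continuous; apply/linear_boundedP.
  exists 1; split=> // r r1 v; apply: le_trans (linear_le_norm pn v) _.
  by rewrite ler_peMl// ltW.
- by exists x; rewrite px oner_neq0.
suff -> : dual_norm p = 1 by rewrite px x1 mulr1.
apply/eqP; rewrite eq_le; apply/andP; split.
  apply: ge_sup; first by exists `|p x|, x; rewrite /unit_ball/= ?x1.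
  by move=> _ [v /= v1 <-]; exact: le_trans (linear_le_norm pn v) v1.
apply: ub_le_sup; last first.
  by exists x; rewrite /unit_ball/= ?x1// px normr1.
by exists 1 => _ [v /= v1 <-]; exact: le_trans (linear_le_norm pn v) v1.
Qed.

Lemma quasi_orthogonal_norm_le x y t :
  quasi_orthogonal y x -> `|x| <= `|x + t *: y|.
Proof.
move=> [p [pC [v0 pv0] px py]].
have [M [M0 pM]] : exists M, 0 < M /\ forall v, `|p v| <= M * `|v|.
  have /linear_bounded_continuous/linear_boundedP/pinfty_ex_gt0[M M0 pM] := pC.
  by exists M.
have dual_ge v : `|v| <= 1 -> `|p v| <= dual_norm p.
  move=> v1; apply: ub_le_sup; last by exists v.
  exists M => _ [u /= u1 <-]; apply: (le_trans (pM u)).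
  by rewrite ler_piMr// ltW.
have p_dual v : `|p v| <= dual_norm p * `|v|.
  have [->|v_neq0] := eqVneq v 0; first by rewrite linear0 !normr0 mulr0.
  have v_gt0 : 0 < `|v| by rewrite normr_gt0.
  have := dual_ge (`|v|^-1 *: v).
  rewrite linearZ/= !normrZ normfV normr_id mulVf ?gt_eqF// => /(_ (lexx 1)).
  by rewrite ler_pdivrMl// mulrC.
have dual_gt0 : 0 < dual_norm p.
  have : 0 < dual_norm p * `|v0|.
    by apply: lt_le_trans (p_dual v0); rewrite normr_gt0.
  rewrite pmulr_lgt0// normr_gt0.
  by apply: contraNneq pv0 => ->; rewrite linear0.
rewrite -(ler_pM2l dual_gt0) -px.
have -> : p x = p (x + t *: y) by rewrite linearD linearZ/= py scaler0 addr0.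
exact: le_trans (ler_norm _) (p_dual _).
Qed.

Lemma unit_vector_kernel p : dim_ge2 X -> exists y, `|y| = 1 /\ p y = 0.
Proof.
move=> [a [b ab]].
suff [y y0 py] : exists2 y, y != 0 & p y = 0.
  exists (`|y|^-1 *: y); rewrite linearZ/= py scaler0; split=> //.
  by rewrite normrZ normfV normr_id mulVf// normr_eq0.
have [pa|pa] := eqVneq (p a) 0.
  exists a => //; apply/eqP => a0.
  have [/eqP] : 1 = 0 :> R /\ 0 = 0 :> R.
    by apply: ab; rewrite a0 scaler0 scale0r addr0.
  by rewrite oner_eq0.
exists (p b *: a - p a *: b).
  apply/eqP; rewrite -scaleNr => /ab[_ /eqP].
  by rewrite oppr_eq0 (negPf pa).
by rewrite linearB !linearZ/= /GRing.scale/= mulrN mulrC subrr.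
Qed.

End supporting_functionals.

(** * The modulus zeta_minus *)

Section zeta_minus_theory.
Context {R : realType} {X : normedModType R}.
Implicit Types (x y : X) (a b r s eps : R).

Lemma zeta_minus_le x y eps : `|x| = 1 -> `|y| = 1 -> quasi_orthogonal y x ->
  zeta_minus X eps <= `|x + eps *: y|.
Proof.
move=> x1 y1 yx; apply: ge_inf; last by exists x, y.
by exists 0 => _ [u [v [_ _ _ ->]]].
Qed.

Context (dimX : dim_ge2 X).

(** Dimension at least [2] enters here: it makes the set of admissible pairs
nonempty, without which the real-valued infimum would be [0]. *)
Lemma le_zeta_minus eps r :
  (forall x y, `|x| = 1 -> `|y| = 1 -> quasi_orthogonal y x ->
     r <= `|x + eps *: y|) -> r <= zeta_minus X eps.
Proof.
move=> rP; apply: lb_le_inf; last by move=> _ [x [y [x1 y1 yx ->]]]; exact: rP.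
have [v [v1 _]] := unit_vector_kernel (\0 : {linear X -> R^o}) dimX.
have [|p [pn pv _]] := @supporting_functional _ _ v 0.
  by move=> t _; rewrite scaler0 addr0.
have [y [y1 py]] := unit_vector_kernel p dimX.
exists `|v + eps *: y|, v, y; split=> //.
by apply: (quasi_orthogonal_supporting pn) => //; rewrite pv.
Qed.

Lemma zeta_minus_ge1 eps : 1 <= zeta_minus X eps.
Proof.
by apply: le_zeta_minus => x y x1 _ yx; rewrite -x1 quasi_orthogonal_norm_le.
Qed.

(** [zeta_minus X] is [1]-Lipschitz, being an infimum of [1]-Lipschitz
functions. *)
Lemma zeta_minus_dist a b : zeta_minus X a <= zeta_minus X b + `|a - b|.
Proof.
rewrite -lerBlDr; apply: le_zeta_minus => x y x1 y1 yx; rewrite lerBlDr.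
apply: le_trans (zeta_minus_le _ x1 y1 yx) _.
have -> : x + a *: y = x + b *: y + (a - b) *: y.
  by rewrite -addrA -scalerDl [b + _]addrC subrK.
by apply: (le_trans (ler_normD _ _)); rewrite normrZ y1 mulr1.
Qed.

Lemma zeta_minus_continuous : continuous (zeta_minus X).
Proof.
move=> a; apply/cvgrPdist_le => e e0; near=> b.
have ab : `|a - b| <= e by near: b; apply: cvgr_dist_le.
have := zeta_minus_dist a b; have := zeta_minus_dist b a.
by rewrite distrC ler_distl; lra.
Unshelve. all: by end_near. Qed.

(** The intermediate value theorem on [[0, r]]: the left-hand side vanishes at
[0], and is at least [r] at [r] because [zeta_minus >= 1]. *)
Lemma zeta_minus_radius r : 0 <= r ->
  exists s, 0 <= s /\ s * zeta_minus X s = r.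
Proof.
move=> r0; pose f s := s * zeta_minus X s.
have fC : {within `[0, r], continuous f}.
  apply: continuous_subspaceT => s.
  by apply: cvgM; [exact: cvg_id|exact: zeta_minus_continuous].
have fr : r <= f r by rewrite ler_peMr// zeta_minus_ge1.
have [|s] := @IVT R f 0 r r r0 fC.
  by rewrite ge_min le_max {1}/f mul0r r0 fr orbT.
by rewrite in_itv/= => /andP[s0 _] fs; exists s.
Qed.

(** [zeta_minus] need not be convex, but each [|x + t y|] is convex in [t] with
value [1] at [0], so its excess over [1] grows at least linearly; this property
survives the infimum and gives strict growth once the excess is positive. *)
Lemma zeta_minus_lt a b : 0 < a -> a < b -> 1 < zeta_minus X a ->
  zeta_minus X a < zeta_minus X b.
Proof.
move=> a0 ab za; have b0 : 0 < b by exact: lt_trans ab.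
pose l := a / b.
have l0 : 0 < l by exact: divr_gt0.
have l1 : l < 1 by rewrite ltr_pdivrMr// mul1r.
have al : a = l * b by rewrite divfK// gt_eqF. clearbody l.
suff : (zeta_minus X a - (1 - l)) / l <= zeta_minus X b.
  rewrite ler_pdivrMr// => H; rewrite -(ltr_pM2r l0); nra.
apply: le_zeta_minus => x y x1 y1 yx; rewrite ler_pdivrMr// lerBlDr.
apply: le_trans (zeta_minus_le _ x1 y1 yx) _.
have -> : x + a *: y = l *: (x + b *: y) + (1 - l) *: x.
  by rewrite scalerDr addrAC -scalerDl [l + _]addrC subrK scale1r scalerA -al.
apply: (le_trans (ler_normD _ _)).
by rewrite !normrZ x1 mulr1 mulrC (gtr0_norm l0) ger0_norm// subr_ge0 ltW.
Qed.

End zeta_minus_theory.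

(** * Nearest points in uniformly convex spaces *)

Section nearest_point.
Context {R : realType}.

Lemma convex_set_comb (X : lmodType R) (C : set X) (x y : X) (l : R) :
  convex_set (M := X) C -> C x -> C y -> 0 <= l -> l <= 1 ->
  C (l *: x + (1 - l) *: y).
Proof.
move=> cC Cx Cy l0 l1.
by have := cC x y (Itv01 l0 l1); rewrite !inE; apply.
Qed.

Lemma norm_add_modulus (X : normedModType R) (x y : X) (t eps : R) :
  0 < t -> `|x| <= t -> `|y| <= t -> eps * t <= `|x - y| ->
  `|x + y| <= 2 * t * (1 - modulus_of_convexity X eps).
Proof.
move=> t0 xt yt xy.
have tV (z : X) : `|t^-1 *: z| = t^-1 * `|z|.
  by rewrite normrZ gtr0_norm// invr_gt0.
suff : modulus_of_convexity X eps <= 1 - `|t^-1 *: x + t^-1 *: y| / 2.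
  rewrite -scalerDr tV => H.
  have -> : `|x + y| = 2 * t * (t^-1 * `|x + y| / 2) by field; rewrite gt_eqF.
  by rewrite ler_pM2l ?mulr_gt0//; lra.
apply: ge_inf.
  exists 0 => _ [u [v [u1 v1 _ ->]]]; rewrite /unit_ball/= in u1 v1.
  by have := ler_normD u v; lra.
exists (t^-1 *: x), (t^-1 *: y); split=> //.
- by rewrite /unit_ball/= tV ler_pdivrMl// mulr1.
- by rewrite /unit_ball/= tV ler_pdivrMl// mulr1.
- by rewrite -scalerBr tV ler_pdivlMl// mulrC.
Qed.

(** Two points of [C] of norm close to [s] cannot be far apart, as otherwise
their midpoint, which lies in [C], would have norm less than [s]. *)
Lemma uniformly_convex_diameter (X : normedModType R) (C : set X) (s e : R) :
  uniformly_convex X -> convex_set (M := X) C -> 0 <= s ->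
  (forall z, C z -> s <= `|z|) -> 0 < e ->
  exists2 t, s < t & forall x y, C x -> C y -> `|x| < t -> `|y| < t ->
    `|x - y| < e.
Proof.
move=> ucX cC + Cs e0; rewrite le_eqVlt => /predU1P[<-|s0].
  exists (e / 2) => [|x y _ _ xe ye]; first by rewrite divr_gt0.
  by have := ler_normB x y; lra.
(* The threshold [t = s * (1 + eta)] is at most [2 * s], so that a distance
   [e] is at least [eps * t], and [(1 + eta) * (1 - d) < 1]. *)
pose eps := Num.min 2 (e / (2 * s)).
have es0 : 0 < e / (2 * s) by rewrite divr_gt0// mulr_gt0.
have eps0 : 0 < eps by rewrite lt_min es0 ltr0n.
have d0 : 0 < modulus_of_convexity X eps by rewrite ucX// ge_min lexx.
set d := modulus_of_convexity X eps in d0.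
pose eta := Num.min 1 d.
have eta0 : 0 < eta by rewrite lt_min ltr01.
have eta1 : eta <= 1 by rewrite ge_min lexx.
have eta_d : eta <= d by rewrite ge_min lexx orbT.
exists (s * (1 + eta)) => [|x y Cx Cy xt yt]; first by nra.
rewrite ltNge; apply/negP => exy.
have t0 : 0 < s * (1 + eta) by nra.
have : eps * (s * (1 + eta)) <= `|x - y|.
  apply: le_trans exy; have : eps <= e / (2 * s) by rewrite ge_min lexx orbT.
  rewrite ler_pdivlMr ?mulr_gt0//; apply: le_trans.
  by rewrite ler_pM2l// mulrC ler_pM2r//; lra.
move=> /(norm_add_modulus t0 (ltW xt) (ltW yt)); rewrite -/d.
have := Cs _ (convex_set_comb (l := 2^-1) cC Cx Cy _ _).
have -> : 1 - 2^-1 = 2^-1 :> R by field.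
rewrite -scalerDr normrZ gtr0_norm ?invr_gt0// => /(_ _ _).
have h0 : (0 : R) <= 2^-1 by rewrite invr_ge0.
have h1 : (2^-1 : R) <= 1 by lra.
move=> /(_ h0 h1) sxy xyd.
have : 2 * s <= 2 * (s * (1 + eta)) * (1 - d) by lra.
have : s * ((1 + eta) * (1 - d)) < s * 1 by rewrite ltr_pM2l//; nra.
by lra.
Qed.

(** [c] is the limit of a minimizing sequence, hence lies in the closure of
[C], possibly outside [C]; so minimality is expressed along the rays from [c]
through the points of [C].  Up to [t = 1] these rays stay in the closure of
[C]; beyond, the inequality persists by convexity of the norm. *)
Lemma nearest_point (X : completeNormedModType R) (C : set X) :
  uniformly_convex X -> convex_set (M := X) C -> C !=set0 ->
  exists c, `|c| = inf [set `|z| | z in C] /\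
    forall z t, C z -> 0 <= t -> `|c| <= `|c + t *: (z - c)|.
Proof.
move=> ucX cC [z0 Cz0]; set N := [set `|z| | z in C]; set s := inf N.
have N0 : N !=set0 by exists `|z0|, z0.
have Nlb : has_lbound N by exists 0 => _ [z _ <-].
have s0 : 0 <= s by apply: lb_le_inf => // _ [z _ <-].
have Cs z : C z -> s <= `|z| by move=> Cz; apply: ge_inf => //; exists z.
have /choice[u uP] n : exists z, C z /\ `|z| < s + n.+1%:R^-1.
  have [|_ [z Cz <-] zs] := @inf_adherent _ N n.+1%:R^-1 _ (conj N0 Nlb).
    by rewrite invr_gt0.
  by exists z.
have Cu n : C (u n) := (uP n).1.
have us n : `|u n| < s + n.+1%:R^-1 := (uP n).2.
have : cauchy (u @ \oo).
  apply: cauchy_exP => e e0.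
  have [t st tP] := uniformly_convex_diameter ucX cC s0 Cs e0.
  have [M _ Mt] : \forall n \near \oo, n.+1%:R^-1 < t - s.
    have ts0 : 0 < t - s by rewrite subr_gt0.
    exact: (near_infty_natSinv_lt (PosNum ts0)).
  have ut n : (M <= n)%N -> `|u n| < t.
    by move=> /Mt /=; rewrite ltrBrDl; exact: lt_trans.
  exists (u M); exists M => // n /= Mn.
  by rewrite -ball_normE/=; apply: tP => //; exact: ut.
move=> /cauchy_cvg/cvg_ex[/= c uc].
have c_le : `|c| <= s.
  have cs : (fun n => s + n.+1%:R^-1) @ \oo --> s.
    rewrite -[X in _ --> X]addr0; apply: cvgD; first exact: cvg_cst.
    exact: cvg_harmonic.
  apply: (ler_cvg_to (cvg_norm uc) cs).
  by apply: nearW => n; exact: ltW.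
have c_ge z t : C z -> 0 <= t -> t <= 1 -> s <= `|c + t *: (z - c)|.
  move=> Cz t0 t1.
  have cvg_seg : (fun n => u n + t *: (z - u n)) @ \oo --> c + t *: (z - c).
    apply: cvgD => //; apply: cvgZ; first exact: cvg_cst.
    apply: cvgB => //; exact: cvg_cst.
  apply: (ler_cvg_to (@cvg_cst _ s _ _ _) (cvg_norm cvg_seg)).
  apply: nearW => n; apply: Cs.
  have -> : u n + t *: (z - u n) = t *: z + (1 - t) *: u n.
    by rewrite scalerBr scalerBl scale1r addrCA addrA.
  exact: convex_set_comb.
have cE : `|c| = s.
  apply/eqP; rewrite eq_le c_le/=.
  by have := c_ge z0 0 Cz0 (lexx 0) ler01; rewrite scale0r addr0.
exists c; split=> // z t Cz t0; rewrite cE.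
have [t1|t1] := leP t 1; first exact: c_ge.
have := c_ge z 1 Cz ler01 (lexx 1).
have tp : 0 < t by exact: lt_trans t1.
have -> : c + 1 *: (z - c) = t^-1 *: (c + t *: (z - c)) + (1 - t^-1) *: c.
  rewrite [t^-1 *: _]scalerDr scalerA mulVf ?gt_eqF// addrAC -scalerDl.
  by rewrite [t^-1 + _]addrC subrK !scale1r.
move=> /le_trans/(_ (ler_normD _ _)).
have tV1 : t^-1 < 1 by rewrite invf_lt1.
rewrite !normrZ cE gtr0_norm ?invr_gt0// gtr0_norm ?subr_gt0// => H.
have : t^-1 * s <= t^-1 * `|c + t *: (z - c)| by lra.
by rewrite ler_pM2l ?invr_gt0.
Qed.

End nearest_point.

(** * Caps of a ball *)

Section caps.
Context {R : realType}.

(** A monotonicity lemma for normed planes: [b] lies in the angle between [a]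
and [- u], and is not longer than [a], so it is not farther from [- u] than [a]
is.  The ray through [b] meets the segment from [- u] to [a] at [k b].  If
[k <= 1], the segments from [0] to [b] and from [- u] to [a] cross and the
triangle inequalities at the crossing point add up to the claim.  If [1 < k],
[b] lies on the segment from [0] to [k b], whose endpoints are both at
distance at most [|u + a|] from [- u]. *)
Lemma norm_monotonicity (X : normedModType R) (u a b : X) (al be : R) :
  0 <= al -> 0 <= be -> a = al *: u + be *: b -> `|b| <= `|a| ->
  `|u| <= `|u + a| -> `|u + b| <= `|u + a|.
Proof.
move=> al0 be0 aE ba ua; pose m := 1 + al; pose k := be / m.
have m1 : 1 <= m by rewrite lerDl.
have m0 : 0 < m by exact: lt_le_trans m1.
have k0 : 0 <= k by rewrite divr_ge0// ltW.
have mk : m * k = be by rewrite mulrC divfK// gt_eqF.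
have uk : m * `|u + k *: b| = `|u + a|.
  rewrite -{1}(gtr0_norm m0) -normrZ; congr (`|_|).
  by rewrite scalerDr scalerA mk scalerDl scale1r -addrA -aE.
have uk_le : `|u + k *: b| <= `|u + a| by rewrite -uk ler_peMl.
have [k1|k1] := leP k 1.
  have ak : m * `|a - k *: b| = al * `|u + a|.
    rewrite -{1}(gtr0_norm m0) -{1}(ger0_norm al0) -!normrZ; congr (`|_|).
    have bE : be *: b = a - al *: u by rewrite aE addrAC subrr add0r.
    rewrite scalerBr scalerA mk bE scalerDl scale1r opprB addrC addrA subrK.
    by rewrite -scalerDr.
  have a_le : `|a| <= k * `|b| + `|a - k *: b|.
    rewrite -{1}(subrK (k *: b) a) addrC.
    by apply: (le_trans (ler_normD _ _)); rewrite normrZ ger0_norm.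
  have ub_le : `|u + b| <= `|u + k *: b| + (1 - k) * `|b|.
    have -> : u + b = (u + k *: b) + (1 - k) *: b.
      by rewrite -addrA -scalerDl [k + _]addrC subrK !scale1r.
    by apply: (le_trans (ler_normD _ _)); rewrite normrZ ger0_norm ?subr_ge0.
  have : `|u + b| <= `|u + k *: b| + `|a - k *: b| by lra.
  rewrite -(ler_pM2l m0) mulrDr uk ak.
  have -> : `|u + a| + al * `|u + a| = m * `|u + a| by rewrite mulrDl mul1r.
  by rewrite ler_pM2l.
have k_gt0 : 0 < k by exact: lt_trans k1.
have kV1 : k^-1 < 1 by rewrite invf_lt1.
have -> : u + b = (1 - k^-1) *: u + k^-1 *: (u + k *: b).
  rewrite scalerDr scalerA mulVf ?gt_eqF// scale1r addrA -scalerDl subrK.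
  by rewrite scale1r.
apply: (le_trans (ler_normD _ _)).
rewrite !normrZ gtr0_norm ?subr_gt0// gtr0_norm ?invr_gt0//.
have : (1 - k^-1) * `|u| <= (1 - k^-1) * `|u + a| by rewrite ler_pM2l ?subr_gt0.
have : k^-1 * `|u + k *: b| <= k^-1 * `|u + a| by rewrite ler_pM2l ?invr_gt0.
lra.
Qed.

(** Normalize [c] to a unit vector [u] with supporting functional [p], and
[w] to [a = w / |c|].  The comparison direction for [a] is the vector [y] of
the kernel of [p] in the plane of [u] and [a], on the same side as [a]: then
[y] is quasi-orthogonal to [u], and norm_monotonicity bounds
[|u + |a| y|] by [|u + a|]. *)
Lemma norm_add_ge_zeta_minus (X : normedModType R) (c w : X) :
  dim_ge2 X -> c != 0 -> w != 0 ->
  (forall t, 0 <= t -> `|c| <= `|c + t *: w|) ->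
  `|c| * zeta_minus X (`|w| / `|c|) <= `|c + w|.
Proof.
move=> dimX c0 w0 cw.
have s0 : 0 < `|c| by rewrite normr_gt0.
have [p [pn pc pw]] := supporting_functional cw.
pose u := `|c|^-1 *: c; pose a := `|c|^-1 *: w.
have u1 : `|u| = 1 by rewrite normrZ normfV normr_id mulVf// gt_eqF.
have pu : p u = 1 by rewrite linearZ/= pc; apply: mulVf; rewrite gt_eqF.
have aE : `|a| = `|w| / `|c| by rewrite normrZ normfV normr_id mulrC.
have a0 : 0 < `|a| by rewrite aE divr_gt0// normr_gt0.
have pa : 0 <= p a by rewrite linearZ/= mulr_ge0.
have uaE : `|u + a| = `|c + w| / `|c|.
  by rewrite -scalerDr normrZ normfV normr_id mulrC.
clearbody u a.
have [y [be [y1 py be0 aD]]] : exists y be,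
    [/\ `|y| = 1, p y = 0, 0 <= be & a = p a *: u + be *: (`|a| *: y)].
  pose d := a - p a *: u.
  have pd : p d = 0 by rewrite linearB linearZ/= pu [_ *: _]mulr1 subrr.
  have [d0|d0] := eqVneq d 0.
    have [y [y1 py]] := unit_vector_kernel p dimX.
    (* [a] is a multiple of [u]: any unit vector of the kernel does *)
    exists y, 0; split=> //; rewrite scale0r addr0.
    by apply/eqP; rewrite -subr_eq0; apply/eqP.
  exists (`|d|^-1 *: d), (`|d| / `|a|); split.
  - by rewrite normrZ normfV normr_id mulVf// normr_eq0.
  - by rewrite linearZ/= pd scaler0.
  - by rewrite divr_ge0.
  rewrite !scalerA divfK ?gt_eqF// divff ?normr_eq0// scale1r.
  by rewrite addrC subrK.
rewrite -ler_pdivlMl// [_^-1 * _]mulrC -uaE -aE.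
have yu := quasi_orthogonal_supporting pn u1 pu py.
apply: le_trans (zeta_minus_le _ u1 y1 yu) _.
apply: norm_monotonicity pa be0 aD _ _.
  by rewrite normrZ normr_id y1 mulr1.
by rewrite u1 uaE ler_pdivlMr// mul1r; have := cw 1 ler01; rewrite scale1r.
Qed.

(** The strict inequality for [zeta_minus X r] together with the existence of a
point of norm at most [rho] forces [zeta_minus X r > 1], which is where the
strict monotonicity of [zeta_minus] begins. *)
Lemma cap_in_ball (X : completeNormedModType R) (C : set X) (r rho : R) :
  dim_ge2 X -> uniformly_convex X -> convex_set (M := X) C -> 0 < r ->
  (exists2 z, C z & `|z| <= rho) ->
  (forall z, C z -> rho < zeta_minus X r * `|z|) ->
  exists c, forall z, C z -> `|z| <= rho -> `|z - c| <= r * rho.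
Proof.
move=> dimX ucX cC r0 [z0 Cz0 z0rho] Crho.
have [c [cE c_near]] := nearest_point ucX cC (ex_intro _ _ Cz0).
set Z := zeta_minus X r in Crho.
have Z1 : 1 <= Z by exact: zeta_minus_ge1.
have Z0 : 0 < Z by exact: lt_le_trans Z1.
have z0_gt0 : 0 < `|z0|.
  have := Crho _ Cz0; have := normr_ge0 z0; rewrite le_eqVlt => /predU1P[|//].
  by move=> z00; move: z0rho; rewrite -z00 mulr0; lra.
have Zgt1 : 1 < Z.
  rewrite lt_neqAle Z1 andbT; apply/eqP => Z1'.
  by have := Crho _ Cz0; rewrite -Z1' mul1r; lra.
have rho0 : 0 < rho by exact: lt_le_trans z0rho.
have c_lo : rho <= Z * `|c|.
  rewrite -ler_pdivrMl// mulrC cE; apply: lb_le_inf; first by exists `|z0|, z0.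
  by move=> _ [z Cz <-]; rewrite ler_pdivrMr// mulrC ltW// Crho.
have c_hi : `|c| <= rho.
  apply: le_trans z0rho; rewrite cE; apply: ge_inf; last by exists z0.
  by exists 0 => _ [z _ <-].
have c0 : 0 < `|c| by nra.
exists c => z Cz z_rho.
have [->|zc] := eqVneq z c; first by rewrite subrr normr0 mulr_ge0// ltW.
suff zcr : `|z - c| / `|c| <= r.
  apply: (@le_trans _ _ (r * `|c|)); first by rewrite -ler_pdivrMr.
  by rewrite ler_pM2l.
rewrite leNgt; apply/negP => /(zeta_minus_lt dimX r0)/(_ Zgt1).
rewrite -/Z => Zlt.
have := @norm_add_ge_zeta_minus X c (z - c) dimX.
rewrite -normr_gt0 c0 subr_eq0 zc => /(_ isT isT (fun t => c_near z t Cz)).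
rewrite [c + _]addrC subrK => zge.
have : Z * `|c| < `|c| * zeta_minus X (`|z - c| / `|c|).
  by rewrite mulrC ltr_pM2l.
lra.
Qed.

End caps.

(** * Colorful Helly property of balls *)

Lemma ball_radius_seqS (R : realType) (X : normedModType R) (j : nat) :
  dim_ge2 X -> 0 <= ball_radius_seq X j.+1 ->
  0 <= ball_radius_seq X j.+2 /\
  ball_radius_seq X j.+2 * zeta_minus X (ball_radius_seq X j.+2) =
    ball_radius_seq X j.+1.
Proof. by move=> dimX /(zeta_minus_radius dimX)/getPex. Qed.

Lemma ball_radius_seq_gt0 (R : realType) (X : normedModType R) (j : nat) :
  dim_ge2 X -> 0 < ball_radius_seq X j.
Proof.
move=> dimX; case: j => [|j]; first exact: ltr01.
elim: j => [|j IH]; first exact: ltr01.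
have [r0 rE] := ball_radius_seqS dimX (ltW IH).
rewrite lt_neqAle r0 andbT; apply: contraTneq IH => r_eq0.
by rewrite -rE -r_eq0 mul0r ltxx.
Qed.

(** The radius [rho] is arbitrary because the induction shrinks it: the step
applies the hypothesis with [rho / zeta_minus X r]. *)
Lemma colorful_helly_ball (R : realType) (X : completeNormedModType R)
    (n : nat) (F : 'I_n.+1 -> set (set X)) (rho : R) :
  dim_ge2 X -> uniformly_convex X ->
  (forall i K, F i K -> convex_set (M := X) K) ->
  (forall K : 'I_n.+1 -> set X, (forall i, F i (K i)) ->
     exists z, (forall i, K i z) /\ `|z| <= rho) ->
  exists x i, forall K, F i K ->
    exists2 z, K z & `|z - x| <= ball_radius_seq X n.+1 * rho.
Proof.
move=> dimX ucX; elim: n F rho => [|n IH] F rho F_convex rainbow.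
  exists 0, ord0 => K FK; have [i|z [Kz zrho]] := rainbow (fun=> K).
    by rewrite ord1.
  by exists z; [exact: (Kz ord0)|rewrite subr0 mul1r].
set r := ball_radius_seq X n.+2.
have r0 : 0 < r by exact: ball_radius_seq_gt0.
have [_ rE] := ball_radius_seqS dimX (ltW (ball_radius_seq_gt0 n.+1 dimX)).
rewrite -/r in rE.
have Z0 : 0 < zeta_minus X r by exact: lt_le_trans (zeta_minus_ge1 dimX r).
pose G (i : 'I_n.+1) := F (lift ord_max i).
have [all_close|] := pselect (forall K : 'I_n.+1 -> set X,
    (forall i, G i (K i)) ->
    exists z, (forall i, K i z) /\ `|z| <= rho / zeta_minus X r).
  have [|x [i xP]] := IH G _ _ all_close; first by move=> i; exact: F_convex.
  exists x, (lift ord_max i) => K /xP[z Kz zx]; exists z => //.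
  by move: zx; rewrite -rE mulrACA divff ?gt_eqF// mulr1.
move=> /existsNP[K /not_implyP[GK K_far]].
pose C := \bigcap_i K i.
have C_convex : convex_set (M := X) C.
  move=> a b l /[!inE] Ca Cb i _.
  have := F_convex _ _ (GK i) a b l; rewrite !inE; apply; [exact: Ca|exact: Cb].
have C_far z : C z -> rho < zeta_minus X r * `|z|.
  move=> Cz; rewrite mulrC -ltr_pdivrMr// ltNge; apply/negP => z_close.
  by apply: K_far; exists z; split=> // i; exact: Cz.
have C_meets L : F ord_max L -> exists z, [/\ L z, C z & `|z| <= rho].
  move=> FL; pose KL i := oapp K L (unlift ord_max i).
  have [i|z [KLz zrho]] := rainbow KL.
    by rewrite /KL; case: unliftP => [j ->|->] //=; exact: GK.
  exists z; split=> //; first by have := KLz ord_max; rewrite /KL unlift_none.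
  by move=> i _; have := KLz (lift ord_max i); rewrite /KL liftK.
have [[L0 FL0]|noL] := pselect (F ord_max !=set0); last first.
  by exists 0, ord_max => L FL; case: noL; exists L.
have [z0 [_ Cz0 z0rho]] := C_meets _ FL0.
have [|c cP] := cap_in_ball dimX ucX C_convex r0 _ C_far; first by exists z0.
exists c, ord_max => L /C_meets[z [Lz Cz zrho]].
by exists z => //; exact: cP.
Qed.

Theorem theorem4p7 (R : realType) (X : completeNormedModType R)
    (dimX : dim_ge2 X) (ucX : uniformly_convex X)
    (k : nat) (k_ge1 : (1 <= k)%N) (F : 'I_k -> set (set X))
    (F_finite : forall i, finite_set (F i))
    (F_nonempty : forall i, F i !=set0)
    (F_convex : forall i (K : set X), F i K -> convex_set (M := X) K)
    (rainbow : forall K : 'I_k -> set X, (forall i, F i (K i)) ->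
       (\bigcap_(i in [set: 'I_k]) K i) `&` unit_ball X !=set0) :
  exists (x : X) (i : 'I_k), forall K : set X, F i K ->
    K `&` [set ball_radius_seq X k *: b + x | b in unit_ball X] !=set0.
Proof.
case: k k_ge1 F F_finite F_nonempty F_convex rainbow => // n _ F _ _ F_convex.
move=> rainbow; have r0 : 0 < ball_radius_seq X n.+1.
  exact: ball_radius_seq_gt0.
have [K FK|x [i xP]] := @colorful_helly_ball R X n F 1 dimX ucX F_convex.
  have [z [Kz z1]] := rainbow K FK.
  by exists z; split=> // i; exact: Kz.
exists x, i => K /xP[z Kz]; rewrite mulr1 => zx.
exists z; split=> //; exists ((ball_radius_seq X n.+1)^-1 *: (z - x)).
  by rewrite /unit_ball/= normrZ gtr0_norm ?invr_gt0// ler_pdivrMl// mulr1.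
by rewrite scalerA divff ?gt_eqF// scale1r subrK.
Qed.
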